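(* Let $\mathsf a=(\mathsf a_\ell)_{\ell\ge0}$, $\mathsf b=(\mathsf b_{\ell,\ell'})_{\ell,\ell'\ge0}$, $\mathsf c=(\mathsf c_{\ell,\ell'})$, $\mathsf d=(\mathsf d_{\ell,\ell'})$, $\mathsf e=(\mathsf e_\ell)_{\ell\ge0}$, $\mathsf f=(\mathsf f_\ell)_{\ell\ge0}$ and $\lambda$ be indeterminates, and for $n\ge0$ define $$\widehat{\widehat Q}_n=\sum_{\sigma\in\mathfrak D_{2n}}\lambda^{\mathrm{cyc}(\sigma)}\prod_{i\in\mathrm{Cval}(\sigma)}\mathsf a_{\mathrm{ucross}(i,\sigma)+\mathrm{unest}(i,\sigma)}\prod_{i\in\mathrm{Cpeak}(\sigma)}\mathsf b_{\mathrm{lcross}(i,\sigma),\mathrm{lnest}(i,\sigma)}\prod_{i\in\mathrm{Cdfall}(\sigma)}\mathsf c_{\mathrm{lcross}(i,\sigma),\mathrm{lnest}(i,\sigma)}\prod_{i\in\mathrm{Cdrise}(\sigma)}\mathsf d_{\mathrm{ucross}'(i,\sigma),\mathrm{unest}'(i,\sigma)}\prod_{i\in\mathrm{Evenfix}(\sigma)}\mathsf e_{\mathrm{psnest}(i,\sigma)}\prod_{i\in\mathrm{Oddfix}(\sigma)}\mathsf f_{\mathrm{psnest}(i,\sigma)}.$$ Then $\sum_{n\ge0}\widehat{\widehat Q}_nt^n$ equals the T-type continued fraction with coefficients $\alpha_{2k-1}=(\lambda+k-1)\,\mathsf a_{k-1}\sum_{\xi=0}^{k-1}\mathsf b_{k-1-\xi,\xi}$,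 $\alpha_{2k}=\bigl(\lambda\mathsf e_k+\sum_{\xi=0}^{k-1}\mathsf c_{k-1-\xi,\xi}\bigr)\bigl(\lambda\mathsf f_k+\sum_{\xi=0}^{k-1}\mathsf d_{k-1-\xi,\xi}\bigr)$ for $k\ge1$, $\delta_1=\lambda^2\mathsf e_0\mathsf f_0$, $\delta_n=0$ for $n\ge2$.
   Context: $\mathfrak D_{2n}$: permutations $\sigma$ of $[2n]$ with $\sigma(2k-1)\ge2k-1$ and $\sigma(2k)\le2k$ for all $k\in[n]$; $\mathrm{cyc}(\sigma)$ = number of cycles (fixed points included). $\mathrm{Cval}(\sigma)=\{i:\sigma^{-1}(i)>i<\sigma(i)\}$, $\mathrm{Cpeak}(\sigma)=\{i:\sigma^{-1}(i)<i>\sigma(i)\}$, $\mathrm{Cdrise}(\sigma)=\{i:\sigma^{-1}(i)<i<\sigma(i)\}$, $\mathrm{Cdfall}(\sigma)=\{i:\sigma^{-1}(i)>i>\sigma(i)\}$; $\mathrm{Evenfix},\mathrm{Oddfix}$ = sets of even/odd fixed points. $\mathrm{ucross}(j,\sigma)=\#\{(i,k,l):i<j<k<l,k=\sigma(i),l=\sigma(j)\}$, $\mathrm{unest}(j,\sigma)=\#\{(i,k,l):i<j<k<l,k=\sigma(j),l=\sigma(i)\}$, $\mathrm{lcross}(k,\sigma)=\#\{(i,j,l):i<j<k<l,i=\sigma(k),j=\sigma(l)\}$, $\mathrm{lnest}(k,\sigma)=\#\{(i,j,l):i<j<k<l,i=\sigma(l),j=\sigma(k)\}$, $\mathrm{ucross}'(k,\sigma)=\#\{(i,j,l):i<j<k<l,k=\sigma(i),l=\sigma(j)\}$,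 $\mathrm{unest}'(k,\sigma)=\#\{(i,j,l):i<j<k<l,k=\sigma(j),l=\sigma(i)\}$; for a fixed point $j$, $\mathrm{psnest}(j,\sigma)=\#\{i<j:\sigma(i)>j\}$. T-type continued fraction with coefficients $(\alpha_n),(\delta_n)$: $1/(1-\delta_1t-\alpha_1t/(1-\delta_2t-\alpha_2t/(1-\delta_3t-\cdots)))$. *)

(* Defs.v *)
From HB Require Import structures.
From mathcomp Require Import all_boot all_order all_algebra all_fingroup.

Set Implicit Arguments.
Unset Strict Implicit.
Unset Printing Implicit Defensive.

Import GRing.Theory.

Section PermutationStatistics.
Variables (m : nat) (s : {perm 'I_m}).
Implicit Types i j k l : 'I_m.

Local Notation s' := (s^-1)%g.

(* The ordinal i : 'I_m stands for the element i.+1 of [m] = {1, ..., m}.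
   Order comparisons are unaffected by this shift, but parities are not:
   they are those of pos i. *)
Definition pos i : nat := i.+1.

(* For m = 2n, this is membership in D_{2n}. *)
Definition Dperm : bool :=
  [forall i, if odd (pos i) then i <= s i else s i <= i].

Definition cyc : nat := #|porbits s|.

Definition Cval : {set 'I_m} := [set i : 'I_m | (i < s' i) && (i < s i)].
Definition Cpeak : {set 'I_m} := [set i : 'I_m | (s' i < i) && (s i < i)].
Definition Cdrise : {set 'I_m} := [set i : 'I_m | s' i < i < s i].
Definition Cdfall : {set 'I_m} := [set i : 'I_m | s i < i < s' i].
Definition Evenfix : {set 'I_m} := [set i : 'I_m | (s i == i) && ~~ odd (pos i)].
Definition Oddfix : {set 'I_m} := [set i : 'I_m | (s i == i) && odd (pos i)].

Definition ucross j : nat :=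
  #|[set x : 'I_m * 'I_m * 'I_m |
      let: (i, k, l) := x in
      [&& i < j, j < k, k < l, k == s i & l == s j]]|.

Definition unest j : nat :=
  #|[set x : 'I_m * 'I_m * 'I_m |
      let: (i, k, l) := x in
      [&& i < j, j < k, k < l, k == s j & l == s i]]|.

Definition lcross k : nat :=
  #|[set x : 'I_m * 'I_m * 'I_m |
      let: (i, j, l) := x in
      [&& i < j, j < k, k < l, i == s k & j == s l]]|.

Definition lnest k : nat :=
  #|[set x : 'I_m * 'I_m * 'I_m |
      let: (i, j, l) := x in
      [&& i < j, j < k, k < l, i == s l & j == s k]]|.

Definition ucross' k : nat :=
  #|[set x : 'I_m * 'I_m * 'I_m |
      let: (i, j, l) := x in
      [&& i < j, j < k, k < l, k == s i & l == s j]]|.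

Definition unest' k : nat :=
  #|[set x : 'I_m * 'I_m * 'I_m |
      let: (i, j, l) := x in
      [&& i < j, j < k, k < l, k == s j & l == s i]]|.

Definition psnest j : nat := #|[set i : 'I_m | (i < j) && (j < s i)]|.

End PermutationStatistics.

Local Open Scope ring_scope.

(* Indeterminates are rendered as arbitrary elements of an arbitrary
   commutative ring R. *)
Definition Qhathat (R : comNzRingType) (a : nat -> R)
    (b c d : nat -> nat -> R) (e f : nat -> R) (lambda : R) (n : nat) : R :=
  \sum_(s : {perm 'I_(2 * n)} | Dperm s)
    lambda ^+ cyc s *
    (\prod_(i in Cval s) a (ucross s i + unest s i)%N) *
    (\prod_(i in Cpeak s) b (lcross s i) (lnest s i)) *
    (\prod_(i in Cdfall s) c (lcross s i) (lnest s i)) *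
    (\prod_(i in Cdrise s) d (ucross' s i) (unest' s i)) *
    (\prod_(i in Evenfix s) e (psnest s i)) *
    (\prod_(i in Oddfix s) f (psnest s i)).

(* The formal power series \sum_n F_n t^n is given by its coefficients. *)
Definition fps (R : Type) := nat -> R.

Section FormalPowerSeries.
Variable R : comNzRingType.
Implicit Types (F G u : fps R) (alpha delta : nat -> R).

Definition fps0 : fps R := fun=> 0.
Definition fps1 : fps R := fun n => (n == 0%N)%:R.
Definition fps_sub F G : fps R := fun n => F n - G n.
Definition fps_scale (x : R) F : fps R := fun n => x * F n.
Definition fps_mul F G : fps R := fun n => \sum_(i < n.+1) F i * G (n - i)%N.
Definition fps_mulX F : fps R := fun n => if n is p.+1 then F p else 0.
Definition fps_exp u (k : nat) : fps R := iter k (fps_mul u) fps1.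

(* 1 / F = \sum_k (1 - F)^k when F has constant term 1: then (1 - F)^k has no
   term of degree less than k, so the coefficient of t^n is a finite sum. *)
Definition fps_inv F : fps R :=
  fun n => \sum_(k < n.+1) fps_exp (fps_sub fps1 F) k n.

Lemma fps_exp_small u k n : u 0%N = 0 -> (n < k)%N -> fps_exp u k n = 0.
Proof.
move=> u0; elim: k n => // k IHk n ltnk.
rewrite /fps_exp iterS /fps_mul big1 // => -[[|i] /= lti] _.
  by rewrite u0 mul0r.
rewrite [iter _ _ _ _]IHk ?mulr0 //.
by case: n ltnk lti => // n ltnk _; rewrite subSS (leq_ltn_trans (leq_subr _ _)).
Qed.

Lemma fps_mulV F n : F 0%N = 1 -> fps_mul F (fps_inv F) n = fps1 n.
Proof.
move=> F0; set u := fps_sub fps1 F.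
have u0 : u 0%N = 0 by rewrite /u /fps_sub F0 subrr.
have FE i : F i = fps1 i - u i by rewrite /u /fps_sub opprB addrC subrK.
have E1 : \sum_(i < n.+1) fps1 i * fps_inv F (n - i)%N = fps_inv F n.
  rewrite big_ord_recl big1 /= => [|i _]; last by rewrite mul0r.
  by rewrite addr0 subn0 mul1r.
have Eu : \sum_(i < n.+1) u i * fps_inv F (n - i)%N
          = \sum_(k < n.+1) fps_exp u k.+1 n.
  rewrite [RHS]exchange_big /=; apply: eq_bigr => i _; rewrite -mulr_sumr.
  congr (_ * _); rewrite /fps_inv -/u.
  have le_ni : ((n - i).+1 <= n.+1)%N by rewrite ltnS leq_subr.
  rewrite (big_ord_widen n.+1 (fun k => fps_exp u k (n - i)%N) le_ni).
  rewrite big_mkcond /=; apply: eq_bigr => k _; case: ifP => // /negbT.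
  by rewrite -leqNgt => lt_k; symmetry; apply: fps_exp_small.
rewrite /fps_mul; under eq_bigr => i _ do rewrite FE mulrBl.
rewrite sumrB E1 Eu /fps_inv -/u big_ord_recl [in X in _ - X]big_ord_recr /=.
by rewrite [fps_mul u _ n](@fps_exp_small u n.+1) // addr0 addrK.
Qed.

(* 1 / (1 - delta_k t - alpha_k t / ( ... / (1 - delta_(k+p-1) t))), the
   continued fraction read from level k on and cut after p levels. *)
Fixpoint Tfrac_trunc alpha delta (p k : nat) : fps R :=
  if p is p'.+1 then
    fps_inv
      (fps_sub (fps_sub fps1 (fps_scale (delta k) (fps_mulX fps1)))
         (fps_scale (alpha k) (fps_mulX (Tfrac_trunc alpha delta p' k.+1))))
  else fps0.

(* F is the T-type continued fraction with coefficients alpha_1, alpha_2, ...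
   and delta_1, delta_2, ...: its truncations converge to F coefficientwise.
   The values alpha 0 and delta 0 are not used. *)
Definition is_Tfraction F alpha delta : Prop :=
  forall n, exists p0, forall p, (p0 <= p)%N ->
    Tfrac_trunc alpha delta p 1 n = F n.

End FormalPowerSeries.

(* Main.v *)
Require Import Defs.
From HB Require Import structures.
From mathcomp Require Import all_boot all_order all_algebra all_fingroup.
From mathcomp Require Import ring zify.
Import GRing.Theory.
Local Open Scope ring_scope.

(* Read a permutation s from left to right: after t steps only the arcs
   i -> s i inside {1, ..., t} are known, a partial matching with k open sources
   and k open targets. Every statistic of t, and whether t is the largest element
   of its cycle (the number of such t is cyc s), is determined by this matching
   and the arcs at t. If t is a cycle peak with s t = w, the path of known arcs
   starting at w ends in exactly one open source v0, and t closes a cycle exactly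
   when s v0 = t; so the choice of the source of t contributes lambda + (k - 1),
   independently of w. Hence the total weight of the completions of a matching
   depends only on t and k, and the generating function counts lattice paths with
   weights a k (cycle valley), lambda f_k + sum d (odd step at the same height),
   lambda e_k + sum c (even step at the same height) and (lambda + k - 1) sum b
   (cycle peak).

   The continued fraction follows by regarding height k before an odd step as
   level 2k and height k before an even step as level 2k - 1: the generating
   function of the paths from level h is then the product of the first h + 1
   tails of the fraction and of the weights of the h descents. *)

Set Implicit Arguments.
Unset Strict Implicit.
Unset Printing Implicit Defensive.

(** * Truncated T-fractions *)

Section PowerSeries.
Variable R : comNzRingType.
Implicit Types F G H : fps R.

(** A coefficient of a product involves only coefficients of at most that degree, so commutativity
    and associativity can be imported from polynomials. *)
Lemma fps_mul_poly F G N n : (n < N)%N ->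
  fps_mul F G n = (\poly_(i < N) F i * \poly_(i < N) G i)`_n.
Proof.
move=> ltnN; rewrite coefM; apply: eq_bigr => i _.
by rewrite !coef_poly !ifT //; apply: leq_ltn_trans ltnN; [rewrite leq_subr | rewrite -ltnS].
Qed.

Lemma eq_fps_mul F F' G G' n : (forall i, (i <= n)%N -> F i = F' i) ->
  (forall i, (i <= n)%N -> G i = G' i) -> fps_mul F G n = fps_mul F' G' n.
Proof.
by move=> eqF eqG; apply: eq_bigr => i _; rewrite eqF ?eqG ?leq_subr // -ltnS.
Qed.

Lemma fps_mulC F G n : fps_mul F G n = fps_mul G F n.
Proof. by rewrite !(@fps_mul_poly _ _ n.+1) // mulrC. Qed.

Lemma fps_mulA F G H n :
  fps_mul F (fps_mul G H) n = fps_mul (fps_mul F G) H n.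
Proof.
have coefP E i : (i <= n)%N -> (\poly_(i < n.+1) E i)`_i = E i :> R.
  by move=> lein; rewrite coef_poly ltnS lein.
rewrite (eq_fps_mul (G' := fun i => (\poly_(i < n.+1) G i * \poly_(i < n.+1) H i)`_i)
  (fun i le_in => esym (coefP F i le_in))); last first.
  by move=> i lein; apply: fps_mul_poly.
rewrite [LHS](_ : _ = (\poly_(i < n.+1) F i * (\poly_(i < n.+1) G i * \poly_(i < n.+1) H i))`_n).
  rewrite mulrA coefM; apply: eq_bigr => i _.
  by rewrite coefP ?leq_subr // -(@fps_mul_poly _ _ n.+1).
by rewrite coefM.
Qed.

Lemma fps_mul1 F n : fps_mul (fps1 R) F n = F n.
Proof.
rewrite /fps_mul big_ord_recl big1 => [|i _]; last by rewrite mul0r.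
by rewrite /fps1 eqxx mul1r subn0 addr0.
Qed.

Lemma fps_mul_scale x F F' G n : (forall i, F i = x * F' i) ->
  fps_mul F G n = x * fps_mul F' G n.
Proof.
by move=> eqF; rewrite /fps_mul mulr_sumr; apply: eq_bigr => i _; rewrite eqF mulrA.
Qed.

Lemma fps_mul_mulX F G n : fps_mul (fps_mulX F) G n = fps_mulX (fps_mul F G) n.
Proof.
rewrite /fps_mul big_ord_recl mul0r add0r; case: n => [|n]; first by rewrite big_ord0.
by apply: eq_bigr => i _; rewrite /= /bump leq0n add1n subSS.
Qed.

Lemma eq_fps_mulX F G : F =1 G -> fps_mulX F =1 fps_mulX G.
Proof. by move=> eqFG [|n] /=. Qed.

(** The denominator has constant term 1, so [fps_mulV] applies; multiplying out and solving for [f]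
    gives a recursion without inverses. *)
Lemma Tfrac_trunc_rec (alpha delta : nat -> R) p j n :
  let f := Tfrac_trunc alpha delta p.+1 j in
  f n = fps1 R n + delta j * fps_mulX f n
        + alpha j * fps_mulX (fps_mul f (Tfrac_trunc alpha delta p j.+1)) n.
Proof.
move=> f; set g := Tfrac_trunc _ _ _ _.
set F := fps_sub (fps_sub (fps1 R) (fps_scale (delta j) (fps_mulX (fps1 R))))
  (fps_scale (alpha j) (fps_mulX g)).
have F0 : F 0%N = 1 by rewrite /F /fps_sub /fps_scale /= /fps1 eqxx !mulr0 !subr0.
have := fps_mulV n F0; rewrite -[fps_inv F]/f => <-.
have -> : fps_mul F f n = fps_mul (fps1 R) f n
   - delta j * fps_mul (fps_mulX (fps1 R)) f n - alpha j * fps_mul (fps_mulX g) f n.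
  rewrite /fps_mul !mulr_sumr -!sumrB; apply: eq_bigr => i _.
  by rewrite /F /fps_sub /fps_scale; ring.
rewrite !fps_mul_mulX (eq_fps_mulX (fps_mul1 f)) (eq_fps_mulX (fps_mulC g f)) fps_mul1.
ring.
Qed.

End PowerSeries.

(** * Lattice paths and products of tails of the fraction *)

Section LatticePaths.
Variables (R : comNzRingType) (A B C D : nat -> R).

(* r is the number of remaining steps; the next step is an odd one (a rise or a
   level step) when r is even. *)
Fixpoint pathsum (r k : nat) : R :=
  if r is r'.+1 then
    if odd r' then A k * pathsum r' k.+1 + D k * pathsum r' k
    else C k * pathsum r' k + B k * pathsum r' k.-1
  else (k == 0%N)%:R.

Lemma pathsum_odd n k :
  pathsum n.*2.+1 k = C k * pathsum n.*2 k + B k * pathsum n.*2 k.-1.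
Proof. by rewrite /= odd_double. Qed.

Lemma pathsum_even n k :
  pathsum n.*2.+2 k = A k * pathsum n.*2.+1 k.+1 + D k * pathsum n.*2.+1 k.
Proof. by rewrite -[LHS]/(if ~~ odd n.*2 then _ else _) odd_double. Qed.

Variables alpha delta : nat -> R.
Hypothesis B0 : B 0 = 0.
Hypothesis alpha_odd : forall k, alpha (k.*2.+1) = A k * B k.+1.
Hypothesis alpha_even : forall k, alpha (k.*2.+2) = C k.+1 * D k.+1.
Hypothesis delta_1 : delta 1%N = C 0 * D 0.
Hypothesis delta_ge2 : forall n, delta n.+2 = 0.

Local Notation T := (Tfrac_trunc alpha delta).

(* The product of the first h + 1 tails of the fraction, cut at depth p, and of
   the weights of the descents from level h to level 0; each descent from an even
   level carries the factor t. *)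
Fixpoint prefix_prod (p h : nat) : fps R :=
  if h is h'.+1 then
    let g := fps_mul (prefix_prod p h') (T (p - h) h.+1) in
    if odd h then fps_scale (B (uphalf h)) g else fps_scale (D h./2) (fps_mulX g)
  else T p 1.
Local Notation g := prefix_prod.

(** Height 0 before an even step would be level -1. Instead, an odd level step at height 0 and the
    even level step that must follow it are merged into [delta 1 = C 0 * D 0]. *)
Lemma prefix_prod0 p n : (0 < p)%N ->
  g p 0 n = fps1 R n + C 0 * D 0 * fps_mulX (g p 0) n + A 0 * fps_mulX (g p 1) n.
Proof.
case: p => // p _; rewrite [LHS](Tfrac_trunc_rec alpha delta p 1 n) delta_1; congr (_ + _).
rewrite (alpha_odd 0) -mulrA; congr (_ * _).
by case: n => [|n] //=; rewrite ?mulr0 // subn1.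
Qed.

(** Since [delta] vanishes from index 2 on, a tail satisfies f = 1 + alpha t f f', with f' the next
    tail; this is multiplied by [F]. In the uses below, the term 1 becomes a descent, and [alpha]
    splits into the weight of an ascent and that of the later descent undoing it. *)
Lemma fps_mul_Trec p h F n : (h.+1 < p)%N ->
  let f := T (p - h.+1) h.+2 in
  fps_mul F f n = F n + alpha h.+2 * fps_mulX (fps_mul (fps_mul F f) (T (p - h.+2) h.+3)) n.
Proof.
move=> lthp f; rewrite {}/f (subnS p h.+1).
case: (p - h.+1)%N (subn_gt0 h.+1 p) => [|q]; first by rewrite lthp.
move=> _; rewrite [q.+1.-1]/= (eq_fps_mul (F' := F) (G' := fun i => fps1 R i
   + alpha h.+2 * fps_mulX (fps_mul (T q.+1 h.+2) (T q h.+3)) i)) //; last first.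
  by move=> i _; rewrite (Tfrac_trunc_rec alpha delta q) delta_ge2 mul0r addr0.
rewrite -(eq_fps_mulX (fps_mulA F _ _)).
rewrite -[fps_mulX (fps_mul F _) n](eq_fps_mulX (fps_mulC _ F)).
rewrite -fps_mul_mulX fps_mulC -[in RHS](fps_mul1 F n) /fps_mul mulr_sumr -big_split.
by apply: eq_bigr => i _ /=; ring.
Qed.

Lemma prefix_prodS_odd p k n :
  g p k.*2.+1 n = B k.+1 * fps_mul (g p k.*2) (T (p - k.*2.+1) k.*2.+2) n.
Proof. by rewrite /= odd_double doubleK. Qed.

Lemma prefix_prodS_even p k n :
  g p k.*2.+2 n =
  D k.+1 * fps_mulX (fps_mul (g p k.*2.+1) (T (p - k.*2.+2) k.*2.+3)) n.
Proof. by rewrite -[LHS]/((if ~~ ~~ odd k.*2 then _ else fps_scale (D k.*2./2.+1) _) n) odd_double doubleK. Qed.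

(** The first step is an even one from height k+1: a level step ([C]) leads to level 2k+2, a fall in
    height ([B]) to level 2k. There is no factor t, since t marks the odd steps only. *)
Lemma prefix_prod_odd p k n : (k.*2.+1 < p)%N ->
  g p k.*2.+1 n = C k.+1 * g p k.*2.+2 n + B k.+1 * g p k.*2 n.
Proof.
move=> ltp; rewrite prefix_prodS_odd fps_mul_Trec // alpha_even prefix_prodS_even.
case: n => [|n] /=; first by ring.
set x := fps_mul _ _ n; set y := fps_mul _ _ n.
suff -> : y = B k.+1 * x by ring.
exact/fps_mul_scale/prefix_prodS_odd.
Qed.

Lemma prefix_prod_even p k n : (k.*2.+2 < p)%N ->
  g p k.*2.+2 n = fps_mulX (fun i => A k.+1 * g p k.*2.+3 i + D k.+1 * g p k.*2.+1 i) n.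
Proof.
move=> ltp; rewrite prefix_prodS_even.
case: n => [|n]; first by rewrite mulr0.
rewrite -[RHS]/(A k.+1 * g p k.+1.*2.+1 n + D k.+1 * g p k.*2.+1 n).
rewrite -[fps_mulX _ _]/(fps_mul (g p k.*2.+1) (T (p - k.*2.+2) k.*2.+3) n).
rewrite fps_mul_Trec // (alpha_odd k.+1) (prefix_prodS_odd p k.+1) doubleS.
rewrite [fps_mul (g p k.*2.+2) _ _](_ : _ =
   D k.+1 * fps_mulX (fps_mul (fps_mul (g p k.*2.+1) (T (p - k.*2.+2) k.*2.+3))
      (T (p - k.*2.+3) k.*2.+4)) n); first by ring.
rewrite -fps_mul_mulX.
exact/fps_mul_scale/prefix_prodS_even.
Qed.

(** The two halves feed each other: odd levels reduce to even levels at the same coefficient, even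
    levels at n+1 to odd levels at n. The bounds say that the highest level reachable in the
    remaining steps is below the cutting depth [p]. *)
Lemma prefix_prodE p k n :
  ((k.*2 + n.*2 < p)%N -> g p k.*2 n = pathsum n.*2 k) /\
  ((k.*2 + n.*2 + 2 < p)%N -> g p k.*2.+1 n = pathsum n.*2.+1 k.+1).
Proof.
elim: n k => [|n IHn] k.
  have ev k' : (k'.*2 < p)%N -> g p k'.*2 0 = pathsum 0 k'.
    case: k' => [|k'] ltp.
      by rewrite prefix_prod0 //= /fps1 !mulr0 !addr0.
    by rewrite doubleS prefix_prod_even.
  rewrite addn0; split=> [|ltp]; first exact: ev.
  rewrite prefix_prod_odd; last lia.
  by rewrite -doubleS !ev //=; lia.
have ev k' : (k'.*2 + n.+1.*2 < p)%N -> g p k'.*2 n.+1 = pathsum n.+1.*2 k'.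
  case: k' => [|k'] ltp; rewrite doubleS pathsum_even.
    rewrite prefix_prod0; last lia.
    rewrite -[fps_mulX (g p 0) _]/(g p 0.*2 n).
    rewrite -[fps_mulX (g p 1) _]/(g p 0.*2.+1 n).
    rewrite (proj1 (IHn 0)) ?(proj2 (IHn 0)); try lia.
    (* At height 0 the descent term of [pathsum] would stay at [0.-1 = 0]; the weight [B 0 = 0]
       removes it. *)
    by rewrite (pathsum_odd n 0) B0 -[fps1 R n.+1]/(0 : R); ring.
  rewrite prefix_prod_even; last lia.
  rewrite -[LHS]/(A k'.+1 * g p k'.+1.*2.+1 n + D k'.+1 * g p k'.*2.+1 n).
  by rewrite !(proj2 (IHn _)) //; lia.
split=> [|ltp]; first exact: ev.
rewrite prefix_prod_odd; last lia.
by rewrite -doubleS !ev ?pathsum_odd //; lia.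
Qed.

Lemma pathsum_Tfraction :
  is_Tfraction (fun n => pathsum n.*2 0) alpha delta.
Proof.
(* At level 0 the prefix product is the truncated fraction itself, and a path of 2n steps needs
   depth greater than 2n. *)
move=> n; exists n.*2.+1 => p lep.
exact: (proj1 (prefix_prodE p 0 n)).
Qed.

End LatticePaths.

(** * Partial matchings *)

(** An element with xi smaller elements in [S] has |S| - 1 - xi larger ones, and each xi occurs
    once. The induction removes the maximum, which lowers the first argument for all other elements;
    hence it runs over all [g]. *)
Lemma sum_rank (R : nmodType) m (g : nat -> nat -> R) (S : {set 'I_m}) :
  \sum_(v in S) g #|[set j in S | (v < j)%N]| #|[set j in S | (j < v)%N]|
  = \sum_(0 <= xi < #|S|) g (#|S| - 1 - xi)%N xi.
Proof.
elim: {S}_.+1 {-2}S (ltnSn #|S|) g => // N IHN S leN g.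
have [->|[x0 Sx0]] := set_0Vmem S; first by rewrite big_set0 cards0 big_geq.
have [M SM maxM] : exists2 M, M \in S & forall j, j \in S -> (j <= M)%N.
  by case: (arg_maxnP (fun i : 'I_m => i : nat) Sx0) => M; exists M.
have cardS : #|S| = #|S :\ M|.+1 by rewrite (cardsD1 M) SM.
rewrite (big_setD1 M) //= cardS big_nat_recr //= addrC; congr (_ + _).
  have ltSM : (#|S :\ M| < N)%N by rewrite -ltnS -cardS.
  transitivity (\sum_(0 <= xi < #|S :\ M|) g (#|S :\ M| - 1 - xi).+1 xi); last first.
    apply: eq_big_nat => xi /andP[_ ltxi]; congr (g _ _).
    by rewrite -subnDA add1n subnSK // subn1.
  rewrite -(IHN _ ltSM (fun x => g x.+1)); apply: eq_bigr => v.
  rewrite in_setD1 => /andP[neqv Sv].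
  have ltvM : (v < M)%N by rewrite ltn_neqAle maxM // andbT.
  congr (g _ _).
    have inM : M \in [set j in S | (v < j)%N] by rewrite inE SM.
    rewrite [LHS](cardsD1 M) inM add1n; congr _.+1.
    by apply: eq_card => j; rewrite !inE andbA.
  apply: eq_card => j; rewrite !inE; case: eqP => //= ->.
  by rewrite ltnNge ltnW ?andbF.
congr (g _ _).
  rewrite subn1 subnn; apply: eq_card0 => j; rewrite !inE.
  by apply/negbTE/negP => /andP[/maxM]; rewrite leqNgt => /negbTE->.
rewrite [in RHS]/=; apply: eq_card => j; rewrite !inE andbC.
have [->|neqj] := eqVneq; first by rewrite ltnn.
case Sj: (j \in S); last by rewrite andbF.
by rewrite ltn_neqAle maxM // (inj_eq val_inj) neqj.
Qed.

Section Stats.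
Variables (m : nat).
Implicit Types (s : {perm 'I_m}) (i j k t v w : 'I_m).

(** A triple counted by [lcross] is determined by its middle entry j, as the others are [s k] and
    the preimage of j. *)
Lemma lcrossE s k :
  lcross s k = #|[set j : 'I_m | [&& s k < j, j < k & k < (s^-1)%g j]%N]|.
Proof.
rewrite -(@card_imset _ _ (fun j => (s k, j, (s^-1)%g j))); last by move=> j j' [].
apply: eq_card => -[[i j] l]; rewrite inE; apply/idP/imsetP.
  case/and5P=> lt1 lt2 lt3 /eqP eqi /eqP eqj; exists j; last by rewrite eqi eqj permK.
  by rewrite inE -eqi lt1 lt2 eqj permK.
by case=> j'; rewrite inE => /and3P[lt1 lt2 lt3] [-> -> ->]; rewrite lt1 lt2 lt3 permKV !eqxx.
Qed.

Lemma lnestE s k :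
  lnest s k = #|[set i : 'I_m | [&& i < s k, s k < k & k < (s^-1)%g i]%N]|.
Proof.
rewrite -(@card_imset _ _ (fun i => (i, s k, (s^-1)%g i))); last by move=> j j' [].
apply: eq_card => -[[i j] l]; rewrite inE; apply/idP/imsetP.
  case/and5P=> lt1 lt2 lt3 /eqP eqi /eqP eqj; exists i; last by rewrite eqi eqj permK.
  by rewrite inE -eqj lt1 lt2 eqi permK.
by case=> j'; rewrite inE => /and3P[lt1 lt2 lt3] [-> -> ->]; rewrite lt1 lt2 lt3 permKV !eqxx.
Qed.

(** Inversion exchanges upper and lower arcs, so the facts on sources follow from those on
    targets. *)
Lemma ucross'V s k : ucross' s k = lcross (s^-1)%g k.
Proof.
apply: eq_card => -[[i j] l]; rewrite !inE.
by rewrite !(eq_sym _ ((s^-1)%g _)) !(can2_eq (permKV s) (permK s)).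
Qed.

Lemma unest'V s k : unest' s k = lnest (s^-1)%g k.
Proof.
apply: eq_card => -[[i j] l]; rewrite !inE [(k == _) && _]andbC.
by rewrite !(eq_sym _ ((s^-1)%g _)) !(can2_eq (permKV s) (permK s)).
Qed.

(** An upper arc passing over j from the left crosses or nests the arc from j according to whether
    it ends before or after [s j]. *)
Lemma ucross_unest s j : (j < s j)%N ->
  (ucross s j + unest s j)%N = #|[set i : 'I_m | (i < j) && (j < s i)]%N|.
Proof.
move=> ltj.
rewrite -(cardsID [set i | (s i < s j)%N] [set i | _ & _]) /ucross /unest; congr (_ + _)%N.
  rewrite -(@card_imset _ _ (fun i => (i, s i, s j))); last by move=> i i' [].
  apply: eq_card => -[[i k] l]; rewrite inE; apply/idP/imsetP.
    case/and5P=> lt1 lt2 lt3 /eqP eqi /eqP eqj; exists i; last by rewrite eqi eqj.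
    by rewrite !inE -eqi -eqj lt1 lt2.
  by case=> i'; rewrite !inE => /andP[/andP[lt1 lt2] lt3] [-> -> ->]; rewrite lt1 lt2 lt3 !eqxx.
rewrite -(@card_imset _ _ (fun i => (i, s j, s i))); last by move=> i i' [].
apply: eq_card => -[[i k] l]; rewrite inE; apply/idP/imsetP.
  case/and5P=> lt1 lt2 lt3 /eqP eqi /eqP eqj; exists i; last by rewrite eqi eqj.
  by rewrite !inE -eqi -eqj lt1 (ltn_trans lt2) // andbT -leqNgt ltnW.
case=> i'; rewrite !inE -leqNgt => /andP[lt3 /andP[lt1 lt2]] [-> -> ->].
rewrite lt1 ltj !eqxx !andbT ltn_neqAle lt3 andbT (inj_eq val_inj) (inj_eq perm_inj).
by rewrite -(inj_eq val_inj) /= gtn_eqF.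
Qed.

Definition cmax s i := [forall j in porbit s i, (j <= i)%N].

Lemma cyc_cmax s : cyc s = #|[set i | cmax s i]|.
Proof.
rewrite /cyc -(@card_in_imset _ _ (porbit s) [set i | cmax s i]).
  apply: eq_card => X; apply/imsetP/imsetP; last by case=> i _ ->; exists i.
  case=> i _ ->; case: (arg_maxnP (fun j : 'I_m => j : nat) (porbit_id s i)) => M iM maxM.
  have eqM : porbit s M = porbit s i by apply/eqP; rewrite eq_porbit_mem.
  by exists M => //; rewrite inE; apply/forall_inP => j; rewrite eqM => /maxM.
move=> i j; rewrite !inE => /forall_inP maxi /forall_inP maxj eqij.
apply/val_inj/eqP; rewrite eqn_leq maxj ?maxi //; first by rewrite eqij porbit_id.
by rewrite -eqij porbit_id.
Qed.

Lemma fconnect_porbit s i j : fconnect s i j = (j \in porbit s i).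
Proof.
apply/idP/porbitP => [/iter_findex <-|[n ->]].
  by exists (findex s i j); rewrite permX.
by rewrite permX fconnect_iter.
Qed.

Implicit Type P : {set 'I_m * 'I_m}.

(** Ordinals start at 0, so for [t : 'I_m] this is the matching before [t] is read, and
    [trunc t.+1 s] the one just after. *)
Definition trunc (t : nat) s : {set 'I_m * 'I_m} :=
  [set x : 'I_m * 'I_m | [&& x.1 < t, x.2 < t & s x.1 == x.2]%N].

(* The open sources (ends of the paths formed by the arcs in P) and the open
   targets (starts of these paths). *)
Definition Ends (t : nat) P : {set 'I_m} :=
  [set i : 'I_m | (i < t)%N && (i \notin [set x.1 | x : 'I_m * 'I_m in P])].
Definition Starts (t : nat) P : {set 'I_m} :=
  [set i : 'I_m | (i < t)%N && (i \notin [set x.2 | x : 'I_m * 'I_m in P])].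

Lemma in_Ends (t : nat) s i : (i \in Ends t (trunc t s)) = (i < t <= s i)%N.
Proof.
rewrite inE; case: ltnP => //= ltit; rewrite leqNgt; congr (~~ _).
apply/imsetP/idP => [[x]|lts]; first by rewrite inE => /and3P[_ lt2 /eqP eqx] ->; rewrite eqx.
by exists (i, s i) => //; rewrite inE ltit lts /=.
Qed.

Lemma in_Starts (t : nat) s i : (i \in Starts t (trunc t s)) = (i < t <= (s^-1)%g i)%N.
Proof.
rewrite inE; case: ltnP => //= ltit; rewrite leqNgt; congr (~~ _).
apply/imsetP/idP => [[x]|lts]; last by exists ((s^-1)%g i, i); rewrite // inE /= ltit lts permKV /=.
by rewrite inE => /and3P[lt1 _ /eqP eqx] ->; rewrite -eqx permK.
Qed.

Definition pmatching (t : nat) P :=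
  [/\ {in P, forall x : 'I_m * 'I_m, (x.1 < t) && (x.2 < t)}%N,
      {in P &, injective (fun x : 'I_m * 'I_m => x.1)} & {in P &, injective (fun x : 'I_m * 'I_m => x.2)}].

Lemma card_free (t : nat) P (pr : 'I_m * 'I_m -> 'I_m) : (t <= m)%N ->
  {in P &, injective pr} -> {in P, forall x, (pr x < t)%N} ->
  #|[set i : 'I_m | (i < t)%N && (i \notin [set pr x | x in P])]| = (t - #|P|)%N.
Proof.
move=> letm injpr ltpr; rewrite -(card_in_imset injpr).
rewrite (_ : [set i : 'I_m | _] = [set i : 'I_m | (i < t)%N] :\: (pr @: P)); last first.
  by apply/setP=> i; rewrite !inE andbC.
rewrite cardsD (setIidPr _); last first.
  by apply/subsetP => _ /imsetP[x Px ->]; rewrite inE ltpr.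
congr (_ - _)%N; rewrite -[RHS](card_ord t) -(@card_imset _ _ (widen_ord letm)); last first.
  by move=> i j /(congr1 val) /= /val_inj.
apply: eq_card => i; rewrite inE; apply/idP/imsetP => [lti|[j _ ->]]; last exact: (ltn_ord j).
by exists (Ordinal lti) => //; apply: val_inj.
Qed.

Lemma card_Ends (t : nat) P : (t <= m)%N -> pmatching t P -> #|Ends t P| = (t - #|P|)%N.
Proof. by move=> letm [ltP inj1 _]; apply: card_free => // x /ltP /andP[]. Qed.

Lemma card_Starts (t : nat) P : (t <= m)%N -> pmatching t P -> #|Starts t P| = (t - #|P|)%N.
Proof. by move=> letm [ltP _ inj2]; apply: card_free => // x /ltP /andP[]. Qed.

Lemma card_pmatching (t : nat) P : (t <= m)%N -> pmatching t P -> (#|P| <= t)%N.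
Proof.
move=> letm [ltP inj1 _]; rewrite -(card_in_imset inj1) -[X in (_ <= X)%N](card_ord t).
rewrite -(@card_imset _ _ (widen_ord letm)); last by move=> i j /(congr1 val) /= /val_inj.
apply/subset_leq_card/subsetP => _ /imsetP[x /ltP /andP[lt1 _] ->].
by apply/imsetP; exists (Ordinal lt1) => //; apply: val_inj.
Qed.

(* Otherwise the arcs would map the set of elements reachable from w injectively
   into itself, avoiding w. *)
Lemma exists_end (t : nat) P w : pmatching t P -> w \in Starts t P ->
  exists2 v, v \in Ends t P & connect [rel i j | (i, j) \in P] w v.
Proof.
move=> [ltP inj1 inj2]; rewrite inE => /andP[ltw notw].
pose C := [set j | connect [rel i j | (i, j) \in P] w j].
have ltC j : j \in C -> (j < t)%N.
  rewrite inE => /connectP[p + ->]; case/lastP: p => // p x.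
  by rewrite rcons_path last_rcons => /andP[_ /ltP /andP[]].
case: (pickP [pred v in C | v \in Ends t P]) => [v /andP[]|noend].
  by rewrite inE; exists v.
have nextP i : i \in C -> exists2 x, x \in P & x.1 = i.
  move=> Ci; have := noend i; rewrite /= Ci inE ltC //= => /negbFE /imsetP[x Px ->].
  by exists x.
pose PC := [set x in P | x.1 \in C].
have lePC : (#|C| <= #|PC|)%N.
  apply: leq_trans (leq_imset_card (fun x => x.1) PC).
  apply/subset_leq_card/subsetP => i Ci; have [x Px eqi] := nextP i Ci.
  by apply/imsetP; exists x; rewrite // inE Px eqi.
have : (#|PC| <= #|C :\ w|)%N.
  rewrite -(@card_in_imset _ _ (fun x => x.2) PC); last first.
    by move=> x y; rewrite !inE => /andP[Px _] /andP[Py _]; apply: inj2.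
  apply/subset_leq_card/subsetP => y /imsetP[[i j]]; rewrite inE /= => /andP[Pij Ci] ->.
  rewrite in_setD1; apply/andP; split.
    by apply: contraNneq notw => <-; apply/imsetP; exists (i, j).
  by move: Ci; rewrite !inE => /connect_trans; apply; apply: connect1.
by move: lePC; rewrite (cardsD1 w C) inE connect0 add1n ltnNge => /negP.
Qed.

(** If [s v = t], the path from [s t] to [v] together with [t] is the whole cycle, and its other
    elements are below [t]. Otherwise [s v] lies in the cycle of [t] and exceeds [t], because [v] is
    still open. *)
Lemma cmax_end s t v : v \in Ends t (trunc t s) ->
  connect [rel i j | (i, j) \in trunc t s] (s t) v -> (s t < t)%N ->
  cmax s t = (s v == t).
Proof.
rewrite in_Ends => /andP[ltvt lets] /connectP[p pathp eqv] ltst.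
have fpathp : fpath s (s t) p.
  by apply: sub_path pathp => i j; rewrite /= inE => /and3P[].
have ltp : {in p, forall j, (j < t)%N}.
  move: pathp; elim: (p) (s t) => // x q IHq y /=; rewrite inE /= => /andP[/and3P[_ ltx _]].
  by move=> /IHq ltq j; rewrite inE => /predU1P[->|/ltq].
have [eqs|neqs] := eqVneq (s v) t.
  have cyc_p : fcycle s [:: t, s t & p].
    by rewrite /= eqxx rcons_path fpathp /= -eqv eqs eqxx.
  apply/forall_inP => j; rewrite -fconnect_porbit (fconnect_cycle cyc_p) ?mem_head //.
  by rewrite !inE => /or3P[/eqP->|/eqP->|/ltp/ltnW] //; apply: ltnW.
apply/negbTE/negP => /forall_inP/(_ (s v)).
have -> : s v \in porbit s t.
  rewrite -fconnect_porbit; apply: connect_trans (fconnect1 s v).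
  by apply: connect_trans (fconnect1 s t) _; apply/connectP; exists p.
by move/(_ isT)=> lest; case/eqP: neqs; apply/val_inj/eqP; rewrite eqn_leq lest.
Qed.

End Stats.

(** * Extension of a partial matching by one element *)

Section Classes.
Variables (m : nat).
Implicit Types (s : {perm 'I_m}) (i j k t v w : 'I_m) (P Y : {set 'I_m * 'I_m}).

Lemma pmatching_extend (t : nat) P Y : pmatching t P -> pmatching t.+1 Y ->
  {in Y, forall x, x.1 \notin [set x.1 | x : 'I_m * 'I_m in P]} ->
  {in Y, forall x, x.2 \notin [set x.2 | x : 'I_m * 'I_m in P]} ->
  pmatching t.+1 (P :|: Y) /\ #|P :|: Y| = (#|P| + #|Y|)%N.
Proof.
move=> [ltP injP1 injP2] [ltY injY1 injY2] notP1 notP2; split.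
  split=> [x|x y|x y]; rewrite !in_setU.
  - by case/orP=> [/ltP/andP[lt1 lt2]|/ltY //]; rewrite !ltnS (ltnW lt1) ltnW.
  - case/orP=> [Px|Yx] /orP[Py|Yy]; [exact: injP1 | | | exact: injY1] => eqxy.
      by case/imsetP: (notP1 y Yy); exists x.
    by case/imsetP: (notP1 x Yx); exists y.
  - case/orP=> [Px|Yx] /orP[Py|Yy]; [exact: injP2 | | | exact: injY2] => eqxy.
      by case/imsetP: (notP2 y Yy); exists x.
    by case/imsetP: (notP2 x Yx); exists y.
rewrite cardsU (_ : P :&: Y = set0) ?cards0 ?subn0 //.
apply/setP=> x; rewrite !inE; apply/negP => /andP[Px /notP1 /imsetP[]].
by exists x.
Qed.

Lemma pmatching1 (t : nat) i j : (i < t)%N -> (j < t)%N -> pmatching t [set (i, j)].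
Proof.
move=> lti ltj; split=> [x|x y|x y]; rewrite !inE.
- by move/eqP->; rewrite lti.
- by move=> /eqP-> /eqP->.
- by move=> /eqP-> /eqP->.
Qed.

Lemma pmatching2 t v w : (v < t)%N -> (w < t)%N -> pmatching t.+1 [set (v, t); (t, w)].
Proof.
move=> ltv ltw; split=> [x|x y|x y]; rewrite !inE.
- by case/pred2P=> -> /=; rewrite !ltnS leqnn ltnW.
- by case/pred2P=> -> /pred2P[]-> //= eqx; move: ltv; rewrite eqx ltnn.
- by case/pred2P=> -> /pred2P[]-> //= eqx; move: ltw; rewrite eqx ltnn.
Qed.

Definition border t s := [set x in trunc t.+1 s | (x.1 == t) || (x.2 == t)].

Lemma in_border t s i j : ((i, j) \in border t s) =
  [&& (i <= t)%N, (j <= t)%N, s i == j & (i == t) || (j == t)].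
Proof. by rewrite !inE /= !ltnS -!andbA. Qed.

Lemma borderE t s : border t s =
  (if (s t <= t)%N then [set (t, s t)] else set0) :|:
  (if ((s^-1)%g t <= t)%N then [set ((s^-1)%g t, t)] else set0).
Proof.
apply/setP=> -[i j]; rewrite in_border in_setU; apply/idP/idP.
  case/and4P=> lei lej /eqP eqj; case/orP=> /eqP eqt.
    by rewrite eqt in eqj *; rewrite eqj lej inE eqxx.
  have eqi : (s^-1)%g t = i by rewrite -eqt -eqj permK.
  by rewrite eqi lei eqt [X in _ || X]inE eqxx orbT.
case/orP; case: ifP; rewrite ?inE // => le_ /eqP[-> ->].
  by rewrite leqnn le_ !eqxx.
by rewrite le_ leqnn permKV !eqxx orbT.
Qed.

(** No arc of [P] meets [t] while all arcs of [Y] do, so the union can be separated again into the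
    old arcs and those added at [t]. *)
Lemma trunc_extend t s P Y : pmatching t P ->
  {in Y, forall x, (x.1 == t) || (x.2 == t)} ->
  (trunc t.+1 s == P :|: Y) = (trunc t s == P) && (border t s == Y).
Proof.
move=> [ltP _ _] tY; have NtP x : x \in P -> (x.1 == t) || (x.2 == t) = false.
  by move/ltP/andP=> [lt1 lt2]; rewrite -!(inj_eq val_inj) /= !ltn_eqF.
have truncE : trunc t s = [set x in trunc t.+1 s | ~~ ((x.1 == t) || (x.2 == t))].
  apply/setP=> x; rewrite !inE negb_or !ltnS [in LHS]ltn_neqAle.
  rewrite [(x.2 < t)%N]ltn_neqAle !(inj_eq val_inj).
  by case: (x.1 == t) (x.2 == t) => [] [] /=; rewrite ?andbF ?andbT.
apply/eqP/andP=> [eqPY|[/eqP defP /eqP defY]].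
  have mem_truncS x : (x \in trunc t.+1 s) = (x \in P) || (x \in Y) by rewrite eqPY in_setU.
  split; apply/eqP/setP=> x; rewrite ?truncE [LHS]in_set mem_truncS.
    by case Px: (x \in P); [rewrite (NtP _ Px) | case Yx: (x \in Y) => //=; rewrite tY].
  by case Yx: (x \in Y); [rewrite tY ?orbT | case Px: (x \in P); rewrite // (NtP _ Px)].
rewrite -defP -defY truncE /border; move: (trunc t.+1 s) => X.
by apply/setP=> x; rewrite in_setU !in_set -andb_orr orNb andbT.
Qed.

Variables (t : 'I_m) (P : {set 'I_m * 'I_m}).
Hypothesis pmP : pmatching t P.

Let leb1 s : (s t <= t)%N -> (t, s t) \in border t s.
Proof. by move=> le_; rewrite in_border leqnn le_ !eqxx. Qed.

Let leb2 s : ((s^-1)%g t <= t)%N -> ((s^-1)%g t, t) \in border t s.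
Proof. by move=> le_; rewrite in_border leqnn le_ permKV !eqxx orbT. Qed.

(** Here and in the next four lemmas, the type of [t] and its neighbours below [t] amount to
    prescribing the matching one step later, so the induction on completions can be applied. *)
Lemma class_fix s : (trunc t s == P) && (s t == t) = (trunc t.+1 s == P :|: [set (t, t)]).
Proof.
rewrite trunc_extend //; last by move=> x; rewrite inE => /eqP-> /=; rewrite eqxx.
congr (_ && _); apply/eqP/eqP => [eqt|eqY].
  have eqVt : (s^-1)%g t = t by apply: (@perm_inj _ s); rewrite permKV eqt.
  by rewrite borderE eqVt eqt leqnn setUid.
have : (t, t) \in border t s by rewrite eqY set11.
by rewrite in_border => /and4P[_ _ /eqP].
Qed.

Lemma class_out s : (trunc t s == P) && ((t < s t) && (t < (s^-1)%g t))%N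
  = (trunc t.+1 s == P :|: set0).
Proof.
rewrite trunc_extend //; last by move=> x; rewrite inE.
congr (_ && _); apply/andP/eqP => [[lt1 lt2]|eqY].
  by rewrite borderE !ifN -?ltnNge ?setU0.
by split; rewrite ltnNge; apply/negP; [move/leb1|move/leb2]; rewrite eqY inE.
Qed.

Lemma class_rise s v : (v < t)%N ->
  (trunc t s == P) && ((t < s t)%N && ((s^-1)%g t == v))
  = (trunc t.+1 s == P :|: [set (v, t)]).
Proof.
move=> ltv; rewrite trunc_extend //; last by move=> x; rewrite inE => /eqP-> /=; rewrite eqxx orbT.
congr (_ && _); apply/andP/eqP => [[lt1 /eqP eqv]|eqY].
  by rewrite borderE eqv ifN -?ltnNge // ifT ?set0U // ltnW.
split.
  rewrite ltnNge; apply/negP => /leb1; rewrite eqY inE => /eqP[eqv _].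
  by move: ltv; rewrite -eqv ltnn.
have : (v, t) \in border t s by rewrite eqY set11.
by rewrite in_border => /and4P[_ _ /eqP <-]; rewrite permK.
Qed.

Lemma class_fall s w : (w < t)%N ->
  (trunc t s == P) && ((s t == w) && (t < (s^-1)%g t)%N)
  = (trunc t.+1 s == P :|: [set (t, w)]).
Proof.
move=> ltw; rewrite trunc_extend //; last by move=> x; rewrite inE => /eqP-> /=; rewrite eqxx.
congr (_ && _); apply/andP/eqP => [[/eqP eqw lt2]|eqY].
  by rewrite borderE eqw ifT ?ifN -?ltnNge ?setU0 // ltnW.
split.
  have : (t, w) \in border t s by rewrite eqY set11.
  by rewrite in_border => /and4P[_ _].
rewrite ltnNge; apply/negP => /leb2; rewrite eqY inE => /eqP[_ eqw].
by move: ltw; rewrite -eqw ltnn.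
Qed.

Lemma class_peak s v w : (v < t)%N -> (w < t)%N ->
  (trunc t s == P) && ((s t == w) && ((s^-1)%g t == v))
  = (trunc t.+1 s == P :|: [set (v, t); (t, w)]).
Proof.
move=> ltv ltw; rewrite trunc_extend //; last first.
  by move=> x; rewrite !inE => /pred2P[]-> /=; rewrite eqxx ?orbT.
congr (_ && _); apply/andP/eqP => [[/eqP eqw /eqP eqv]|eqY].
  by rewrite borderE eqw eqv (ltnW ltv) (ltnW ltw) setUC.
split.
  have : (t, w) \in border t s by rewrite eqY !inE eqxx orbT.
  by rewrite in_border => /and4P[_ _].
have : (v, t) \in border t s by rewrite eqY !inE eqxx.
by rewrite in_border => /and4P[_ _ /eqP <-]; rewrite permK.
Qed.

(** The cardinalities give the new height, t + 1 minus the number of arcs: one new arc keeps the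
    height and two new arcs lower it by one. *)
Lemma pmatching_fix :
  pmatching t.+1 (P :|: [set (t, t)]) /\ #|P :|: [set (t, t)]| = #|P|.+1.
Proof.
have [ltP _ _] := pmP; have [||pm ->] := pmatching_extend pmP (pmatching1 (ltnSn t) (ltnSn t)).
- move=> x; rewrite inE => /eqP-> /=; apply/imsetP=> -[y /ltP /andP[+ _] eqy].
  by rewrite -eqy ltnn.
- move=> x; rewrite inE => /eqP-> /=; apply/imsetP=> -[y /ltP /andP[_ +] eqy].
  by rewrite -eqy ltnn.
by rewrite cards1 addn1.
Qed.

Lemma pmatching_rise v : v \in Ends t P ->
  pmatching t.+1 (P :|: [set (v, t)]) /\ #|P :|: [set (v, t)]| = #|P|.+1.
Proof.
rewrite inE => /andP[ltv notv]; have [ltP _ _] := pmP.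
have [||pm ->] := pmatching_extend pmP (pmatching1 (ltnW ltv : (v < t.+1)%N) (ltnSn t)).
- by move=> x; rewrite inE => /eqP->.
- move=> x; rewrite inE => /eqP-> /=; apply/imsetP=> -[y /ltP /andP[_ +] eqy].
  by rewrite -eqy ltnn.
by rewrite cards1 addn1.
Qed.

Lemma pmatching_fall w : w \in Starts t P ->
  pmatching t.+1 (P :|: [set (t, w)]) /\ #|P :|: [set (t, w)]| = #|P|.+1.
Proof.
rewrite inE => /andP[ltw notw]; have [ltP _ _] := pmP.
have [||pm ->] := pmatching_extend pmP (pmatching1 (ltnSn t) (ltnW ltw : (w < t.+1)%N)).
- move=> x; rewrite inE => /eqP-> /=; apply/imsetP=> -[y /ltP /andP[+ _] eqy].
  by rewrite -eqy ltnn.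
- by move=> x; rewrite inE => /eqP->.
by rewrite cards1 addn1.
Qed.

Lemma pmatching_peak v w : v \in Ends t P -> w \in Starts t P ->
  pmatching t.+1 (P :|: [set (v, t); (t, w)]) /\
  #|P :|: [set (v, t); (t, w)]| = #|P|.+2.
Proof.
rewrite !inE => /andP[ltv notv] /andP[ltw notw]; have [ltP _ _] := pmP.
have [||pm ->] := pmatching_extend pmP (pmatching2 ltv ltw).
- move=> x; rewrite !inE => /pred2P[]-> //=; apply/imsetP=> -[y /ltP /andP[+ _] eqy].
  by rewrite -eqy ltnn.
- move=> x; rewrite !inE => /pred2P[]-> //=; apply/imsetP=> -[y /ltP /andP[_ +] eqy].
  by rewrite -eqy ltnn.
have neq : (v, t) != (t, w) by apply: contraTneq ltv => -[-> _]; rewrite ltnn.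
by rewrite cards2 neq addn2.
Qed.

End Classes.

(** Once everything is read, a permutation leaves no open source; conversely a matching without open
    sources is the graph of exactly one permutation. This is the end condition of [pathsum]. *)
Lemma card_full_trunc m (P : {set 'I_m * 'I_m}) : pmatching m P ->
  #|[set s | trunc m s == P]| = (m - #|P| == 0)%N.
Proof.
move=> pmP; have [ltP inj1 inj2] := pmP; rewrite -(card_Ends (leqnn m) pmP) cards_eq0.
have [E0|[i0 Ei0]] := set_0Vmem (Ends m P); last first.
  rewrite (_ : _ == _ = false); last by apply/negP => /eqP E0; rewrite E0 inE in Ei0.
  apply: eq_card0 => s; rewrite !inE; apply/negP => /eqP defP.
  by move: Ei0; rewrite -defP in_Ends => /andP[_]; rewrite leqNgt ltn_ord.
have PP i : {j | (i, j) \in P}.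
  case: (pickP [pred j | (i, j) \in P]) => [j Pij|noj]; first by exists j.
  have : i \in Ends m P; last by rewrite E0 inE.
  rewrite inE ltn_ord; apply/imsetP=> -[[i' j] Pij /= eqi].
  by have := noj j; rewrite /= eqi Pij.
have injf : injective (fun i => sval (PP i)).
  move=> i j; case: (PP i) (PP j) => [i' Pi] [j' Pj] /= eqij.
  by rewrite eqij in Pi; case: (inj2 _ _ Pi Pj erefl).
rewrite E0 eqxx (_ : [set s | _] = [set perm injf]) ?cards1 //.
apply/setP=> s; rewrite !inE; apply/eqP/eqP=> [defP|->].
  apply/permP=> i; rewrite permE; case: (PP i) => j /=.
  by rewrite -defP inE => /and3P[_ _ /eqP].
apply/setP=> -[i j]; rewrite inE !ltn_ord /= permE; case: (PP i) => j' Pij' /=.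
apply/eqP/idP=> [<- //|Pij]; by case: (inj1 _ _ Pij Pij' erefl).
Qed.

(** * Weights *)

Section Statistics.
Variables (m : nat).
Implicit Types (s : {perm 'I_m}) (i j k t v w : 'I_m).

Lemma Starts_inv (t : nat) s : Starts t (trunc t (s^-1)%g) = Ends t (trunc t s).
Proof. by apply/setP=> i; rewrite in_Starts in_Ends invgK. Qed.

Lemma psnest_Ends s t : s t = t -> psnest s t = #|Ends t (trunc t s)|.
Proof.
move=> eqt; apply: eq_card => i; rewrite in_Ends inE; case: ltnP => //= ltit.
rewrite ltn_neqAle (inj_eq val_inj) -{1}eqt (inj_eq perm_inj).
by rewrite -(inj_eq val_inj) gtn_eqF.
Qed.

(** The preimage of [t] lies beyond [t], so no open source is sent to [t] and each one has its image
    strictly beyond. *)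
Lemma ucross_unest_Ends s t : (t < s t)%N -> (t < (s^-1)%g t)%N ->
  (ucross s t + unest s t)%N = #|Ends t (trunc t s)|.
Proof.
move=> lt1 lt2; rewrite ucross_unest //; apply: eq_card => i; rewrite in_Ends inE.
case: ltnP => //= ltit; rewrite ltn_neqAle (inj_eq val_inj).
by case: eqP => // eqt; move: lt2; rewrite {2}eqt permK ltnNge ltnW.
Qed.

Lemma lt_preim s t j : s t != j -> (t < (s^-1)%g j)%N = (t <= (s^-1)%g j)%N.
Proof.
move=> neqj; rewrite [in LHS]ltn_neqAle; case: eqP => // /val_inj eqt.
by rewrite eqt permKV eqxx in neqj.
Qed.

(** With the next lemma for [lnest]: the open targets other than [s t] are reached from beyond [t];
    those above [s t] give crossings and those below give nestings. These are the two counts in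
    [sum_rank]. *)
Lemma lcross_Starts s t :
  lcross s t = #|[set j in Starts t (trunc t s) | (s t < j)%N]|.
Proof.
rewrite lcrossE; apply: eq_card => j; rewrite [LHS]inE [RHS]inE in_Starts.
case: (ltnP (s t) j); rewrite ?andbF // => ltj; rewrite lt_preim ?andbT //.
by apply: contraTneq ltj => ->; rewrite ltnn.
Qed.

Lemma lnest_Starts s t : (s t < t)%N ->
  lnest s t = #|[set j in Starts t (trunc t s) | (j < s t)%N]|.
Proof.
move=> ltst; rewrite lnestE; apply: eq_card => j; rewrite [LHS]inE [RHS]inE in_Starts.
rewrite ltst /=; case: (ltnP j (s t)); rewrite ?andbF // => ltj.
rewrite andbT (ltn_trans ltj ltst) lt_preim //.
by apply: contraTneq ltj => ->; rewrite ltnn.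
Qed.

Lemma ucross'_Ends s t :
  ucross' s t = #|[set j in Ends t (trunc t s) | ((s^-1)%g t < j)%N]|.
Proof. by rewrite ucross'V lcross_Starts Starts_inv. Qed.

Lemma unest'_Ends s t : ((s^-1)%g t < t)%N ->
  unest' s t = #|[set j in Ends t (trunc t s) | (j < (s^-1)%g t)%N]|.
Proof. by move=> lt2; rewrite unest'V lnest_Starts // Starts_inv. Qed.

Lemma cmax_fix s t : s t = t -> cmax s t.
Proof.
move=> eqt; apply/forall_inP=> j /porbitP[n ->].
suff -> : (s ^+ n)%g t = t by [].
by rewrite permX; elim: n => //= n ->.
Qed.

Lemma cmaxF s t j : j \in porbit s t -> (t < j)%N -> cmax s t = false.
Proof. by move=> tj lttj; apply/negbTE/negP => /forall_inP/(_ j tj); rewrite leqNgt lttj. Qed.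

Lemma mem_porbit1 s t : s t \in porbit s t.
Proof. by rewrite -fconnect_porbit fconnect1. Qed.

Lemma mem_porbitV s t : (s^-1)%g t \in porbit s t.
Proof. by rewrite -porbitV mem_porbit1. Qed.

End Statistics.

(** * Total weight of the completions of a matching *)

Section WeightedSum.
Variables (R : comNzRingType) (a : nat -> R) (b c d : nat -> nat -> R).
Variables (e f : nat -> R) (lambda : R) (m : nat).
Implicit Types (s : {perm 'I_m}) (i j t v w : 'I_m) (P Y : {set 'I_m * 'I_m}).

(* Zero when i violates the defining condition of a D-permutation, so that sums
   over all permutations reduce to sums over D-permutations. *)
Definition wt s i : R :=
  (if cmax s i then lambda else 1) *
  (if odd (pos i) then
     if s i == i then f (psnest s i)
     else if (s i < i)%N then 0
     else if (i < (s^-1)%g i)%N then a (ucross s i + unest s i)%N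
     else d (ucross' s i) (unest' s i)
   else
     if s i == i then e (psnest s i)
     else if (i < s i)%N then 0
     else if (i < (s^-1)%g i)%N then c (lcross s i) (lnest s i)
     else b (lcross s i) (lnest s i)).

Definition wt_from s (t : nat) := \prod_(i < m | (t <= i)%N) wt s i.

Lemma wt_fromS s t : wt_from s t = wt s t * wt_from s t.+1.
Proof.
rewrite /wt_from (bigD1 t) //=; congr (_ * _); apply: eq_bigl => i.
by rewrite ltn_neqAle andbC -(inj_eq val_inj) eq_sym.
Qed.

(** The names [rise_wt] and [fall_wt] refer to cycle double rises and falls, joined by odd and even
    fixed points respectively; in the lattice path both weigh level steps. *)
Definition rise_wt k := lambda * f k + \sum_(0 <= xi < k) d (k - 1 - xi)%N xi.
Definition fall_wt k := lambda * e k + \sum_(0 <= xi < k) c (k - 1 - xi)%N xi.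
Definition peak_wt k := (lambda + k%:R - 1) * \sum_(0 <= xi < k) b (k - 1 - xi)%N xi.

Lemma sum_split t P (F : {perm 'I_m} -> R) :
  \sum_(s | trunc t s == P) F s =
    \sum_(s | (trunc t s == P) && (s t == t)) F s
  + \sum_(s | (trunc t s == P) && ((t < s t) && (t < (s^-1)%g t))%N) F s
  + \sum_(s | (trunc t s == P) && ((t < s t) && ((s^-1)%g t < t))%N) F s
  + \sum_(s | (trunc t s == P) && ((s t < t) && (t < (s^-1)%g t))%N) F s
  + \sum_(s | (trunc t s == P) && ((s t < t) && ((s^-1)%g t < t))%N) F s.
Proof.
rewrite !big_mkcondr -!big_split; apply: eq_bigr => s _ /=.
have [eqt|neqt] := eqVneq (s t) t.
  have eqVt : (s^-1)%g t = t by apply: (@perm_inj _ s); rewrite permKV eqt.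
  by rewrite eqt eqVt ltnn !addr0.
have neqVt : (s^-1)%g t != t by apply: contra_neq neqt => {1}<-; rewrite permKV.
rewrite -!(inj_eq val_inj) /= in neqt neqVt.
by case: ltngtP neqt => // _ _; case: ltngtP neqVt => //= _ _; rewrite ?addr0 ?add0r.
Qed.

Section Step.
Variables (t : 'I_m) (P : {set 'I_m * 'I_m}) (V : nat -> R).
Hypothesis pmP : pmatching t P.
Hypothesis sum_next : forall P', pmatching t.+1 P' ->
  \sum_(s | trunc t.+1 s == P') wt_from s t.+1 = V (t.+1 - #|P'|)%N.
Let k := (t - #|P|)%N.

Let let_m : (t <= m)%N. Proof. exact: ltnW. Qed.

(** When the class fixes the next matching and the weight of [t] is constant on it, this weight
    factors out and the rest is the induction hypothesis [sum_next]. *)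
Lemma class_sum P' (W : R) (cond : pred {perm 'I_m}) :
  pmatching t.+1 P' ->
  (forall s, (trunc t s == P) && cond s = (trunc t.+1 s == P')) ->
  (forall s, trunc t s = P -> cond s -> wt s t = W) ->
  \sum_(s | (trunc t s == P) && cond s) wt_from s t = W * V (t.+1 - #|P'|)%N.
Proof.
move=> pmP' condE wtE; rewrite -sum_next // mulr_sumr; apply: eq_big => // s.
by case/andP=> /eqP truncs conds; rewrite wt_fromS wtE.
Qed.

Lemma sum_fix : \sum_(s | (trunc t s == P) && (s t == t)) wt_from s t
  = lambda * (if odd (pos t) then f k else e k) * V k.
Proof.
have [pm card] := pmatching_fix pmP.
rewrite (class_sum (W := lambda * (if odd (pos t) then f k else e k)) pm (class_fix pmP)).
  by rewrite card subSS.
move=> s defP /eqP eqt.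
by rewrite /wt (cmax_fix eqt) eqt eqxx psnest_Ends // defP card_Ends.
Qed.

Lemma sum_out : \sum_(s | (trunc t s == P) && ((t < s t) && (t < (s^-1)%g t))%N) wt_from s t
  = if odd (pos t) then a k * V k.+1 else 0.
Proof.
have pm : pmatching t.+1 (P :|: set0).
  rewrite setU0; have [ltP inj1 inj2] := pmP; split=> // x /ltP /andP[lt1 lt2].
  by rewrite !ltnS (ltnW lt1) (ltnW lt2).
rewrite (class_sum (W := if odd (pos t) then a k else 0) pm (class_out pmP)).
  rewrite setU0 subSn ?card_pmatching // -/k; by case: ifP; rewrite ?mul0r.
move=> s defP /andP[lt1 lt2]; rewrite /wt (cmaxF (mem_porbit1 s t) lt1) mul1r.
rewrite -(inj_eq val_inj) /= gtn_eqF // lt1 [(s t < t)%N]ltnNge ltnW //= lt2.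
by rewrite ucross_unest_Ends // defP card_Ends.
Qed.

Lemma sum_rise :
  \sum_(s | (trunc t s == P) && ((t < s t) && ((s^-1)%g t < t))%N) wt_from s t
  = if odd (pos t) then (\sum_(0 <= xi < k) d (k - 1 - xi)%N xi) * V k else 0.
Proof.
(* The open source [v] sent to [t] determines the next matching; its rank among the open sources
   gives the arguments of [d]. *)
rewrite (partition_big (fun s => (s^-1)%g t) (mem (Ends t P))) /=; last first.
  by move=> s /and3P[/eqP <- lt1 lt2]; rewrite in_Ends lt2 permKV leqnn.
transitivity (\sum_(v in Ends t P) (if odd (pos t) then
    d #|[set j in Ends t P | (v < j)%N]| #|[set j in Ends t P | (j < v)%N]| else 0) * V k).
  apply: eq_bigr => v Ev; have [pm card] := pmatching_rise pmP Ev.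
  have ltv : (v < t)%N by move: Ev; rewrite inE => /andP[].
  have -> : k = (t.+1 - #|P :|: [set (v, t)]|)%N by rewrite card subSS.
  rewrite -(class_sum pm (fun s => class_rise pmP s ltv)).
    apply: eq_bigl => s; rewrite -!andbA; do 2!congr (_ && _).
    by apply: andb_idl => /eqP->.
  move=> s defP /andP[lt1 /eqP eqv]; have lt2 : ((s^-1)%g t < t)%N by rewrite eqv.
  rewrite /wt (cmaxF (mem_porbit1 s t) lt1) mul1r.
  rewrite -(inj_eq val_inj) /= gtn_eqF // lt1 [(s t < t)%N]ltnNge ltnW //=.
  by rewrite ltnNge ltnW //= ucross'_Ends unest'_Ends // eqv defP.
rewrite -mulr_suml /pos /=; case: (odd t) => /=; first by rewrite big1_eq mul0r.
by rewrite sum_rank card_Ends.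
Qed.

Lemma sum_fall :
  \sum_(s | (trunc t s == P) && ((s t < t) && (t < (s^-1)%g t))%N) wt_from s t
  = if odd (pos t) then 0 else (\sum_(0 <= xi < k) c (k - 1 - xi)%N xi) * V k.
Proof.
rewrite (partition_big (fun s => s t) (mem (Starts t P))) /=; last first.
  by move=> s /and3P[/eqP <- lt1 lt2]; rewrite in_Starts lt1 permK leqnn.
transitivity (\sum_(w in Starts t P) (if odd (pos t) then 0 else
    c #|[set j in Starts t P | (w < j)%N]| #|[set j in Starts t P | (j < w)%N]|) * V k).
  apply: eq_bigr => w Sw; have [pm card] := pmatching_fall pmP Sw.
  have ltw : (w < t)%N by move: Sw; rewrite inE => /andP[].
  have -> : k = (t.+1 - #|P :|: [set (t, w)]|)%N by rewrite card subSS.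
  rewrite -(class_sum pm (fun s => class_fall pmP s ltw)).
    apply: eq_bigl => s; rewrite -!andbA; congr (_ && _); rewrite andbA andbC.
    by case: eqP => //= ->; rewrite ltw.
  move=> s defP /andP[/eqP eqw lt2]; have lt1 : (s t < t)%N by rewrite eqw.
  rewrite /wt (cmaxF (mem_porbitV s t) lt2) mul1r.
  rewrite -(inj_eq val_inj) /= ltn_eqF // lt1 [(t < s t)%N]ltnNge ltnW //= lt2.
  by rewrite lcross_Starts lnest_Starts // eqw defP.
rewrite -mulr_suml /pos /=; case: (odd t) => /=; last by rewrite big1_eq mul0r.
by rewrite sum_rank card_Starts.
Qed.

Lemma sum_peak :
  \sum_(s | (trunc t s == P) && ((s t < t) && ((s^-1)%g t < t))%N) wt_from s t
  = if odd (pos t) then 0 else peak_wt k * V k.-1.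
Proof.
rewrite (partition_big (fun s => s t) (mem (Starts t P))) /=; last first.
  by move=> s /and3P[/eqP <- lt1 lt2]; rewrite in_Starts lt1 permK leqnn.
transitivity (\sum_(w in Starts t P) (if odd (pos t) then 0 else (lambda + k%:R - 1) *
    b #|[set j in Starts t P | (w < j)%N]| #|[set j in Starts t P | (j < w)%N]|) * V k.-1);
    last first.
  rewrite -mulr_suml /pos /=; case: (odd t) => /=; last by rewrite big1_eq mul0r.
  by rewrite -mulr_sumr sum_rank card_Starts.
apply: eq_bigr => w Sw; have ltw : (w < t)%N by move: Sw; rewrite inE => /andP[].
rewrite (partition_big (fun s => (s^-1)%g t) (mem (Ends t P))) /=; last first.
  by move=> s /andP[/and3P[/eqP <- lt1 lt2] _]; rewrite in_Ends lt2 permKV leqnn.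
(* The known path from the target [w] ends at [v0], so [t] closes a cycle exactly when its source is
   [v0]. *)
have [v0 Ev0 v0P] := exists_end pmP Sw.
transitivity (\sum_(v in Ends t P) (if odd (pos t) then 0 else (if v0 == v then lambda else 1) *
    b #|[set j in Starts t P | (w < j)%N]| #|[set j in Starts t P | (j < w)%N]|) * V k.-1).
  apply: eq_bigr => v Ev; have [pm card] := pmatching_peak pmP Ev Sw.
  have ltv : (v < t)%N by move: Ev; rewrite inE => /andP[].
  have -> : k.-1 = (t.+1 - #|P :|: [set (v, t); (t, w)]|)%N by rewrite card subSS subnS.
  rewrite -(class_sum pm (fun s => class_peak pmP s ltv ltw)).
    apply: eq_bigl => s; rewrite -!andbA; congr (_ && _).
    case: (eqVneq (s t) w) => [->|_]; last by rewrite !andbF.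
    by case: (eqVneq _ v) => [->|_]; rewrite ?andbF // ltw ltv.
  move=> s defP /andP[/eqP eqw /eqP eqv].
  have lt1 : (s t < t)%N by rewrite eqw.
  have cmaxE : cmax s t = (v0 == v).
    rewrite (@cmax_end _ s t v0) ?defP ?eqw // -eqv.
    by rewrite (can2_eq (permK s) (permKV s)).
  rewrite /wt cmaxE -[s t == t](inj_eq val_inj) /= ltn_eqF // lt1 [(t < s t)%N]ltnNge ltnW //=.
  rewrite eqv [(t < v)%N]ltnNge ltnW // lcross_Starts lnest_Starts // eqw defP.
  by rewrite /pos /=; case: (odd t) => /=; rewrite ?mulr0.
rewrite -mulr_suml; congr (_ * _); rewrite /pos /=; case: (odd t) => /=; last by rewrite big1_eq.
rewrite -mulr_suml (bigD1 v0) //= eqxx; congr (_ * _); rewrite -addrA; congr (_ + _).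
rewrite (eq_bigr (fun=> 1)) => [|v /andP[_ /negbTE]]; last by rewrite eq_sym => ->.
(* The open sources other than [v0] contribute 1 each, and there are k - 1 of them. *)
rewrite /k -(card_Ends let_m pmP) (cardD1 v0) Ev0 natrD addrC addKr sumr_const.
by congr (_ *+ _); apply: eq_card => v; rewrite [LHS]unfold_in [RHS]inE andbC.
Qed.

End Step.

Local Notation V := (pathsum a peak_wt fall_wt rise_wt).

Lemma sum_wt_from (r t : nat) (P : {set 'I_m * 'I_m}) :
  ~~ odd m -> (t + r)%N = m -> pmatching t P ->
  \sum_(s | trunc t s == P) wt_from s t = V r (t - #|P|)%N.
Proof.
move=> evm; elim: r t P => [|r IHr] t P defm pmP.
  rewrite addn0 in defm; rewrite {t}defm in pmP *.
  rewrite (eq_bigr (fun=> 1)) => [|s _]; last first.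
    by rewrite /wt_from big_pred0 // => i; rewrite leqNgt ltn_ord.
  rewrite sumr_const -[RHS]/((m - #|P| == 0)%N%:R) -(card_full_trunc pmP); congr (_ *+ _).
  by apply: eq_card => s; rewrite [RHS]inE.
have lttm : (t < m)%N by rewrite -defm addnS ltnS leq_addr.
pose t' := Ordinal lttm; rewrite -[t]/(val t') in pmP defm *.
have next P' : pmatching t'.+1 P' ->
    \sum_(s | trunc t'.+1 s == P') wt_from s t'.+1 = V r (t'.+1 - #|P'|)%N.
  by apply: IHr; rewrite addSnnS.
(* The element read and the [r] elements after it satisfy [pos t' + r = m] with [m] even, which
   matches the parity test in [pathsum]. *)
have oddt : odd (pos t') = odd r.
  have : odd (pos t' + r) = odd m by rewrite /pos addSnnS defm.
  by rewrite oddD (negbTE evm); case: (odd (pos t')) (odd r) => [] [].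
rewrite sum_split (sum_fix pmP next) (sum_out pmP next) (sum_rise pmP next).
rewrite (sum_fall pmP next) (sum_peak pmP next) oddt /= /rise_wt /fall_wt.
by case: (odd r); ring.
Qed.

(** An element violating the D-condition contributes a factor 0. Otherwise every product is extended
    over all elements by factors 1 and the comparison is made element by element; parity then
    separates valleys and double rises from peaks and double falls. *)
Lemma prod_wt s : \prod_i wt s i =
  if Dperm s then
    lambda ^+ cyc s *
    (\prod_(i in Cval s) a (ucross s i + unest s i)%N) *
    (\prod_(i in Cpeak s) b (lcross s i) (lnest s i)) *
    (\prod_(i in Cdfall s) c (lcross s i) (lnest s i)) *
    (\prod_(i in Cdrise s) d (ucross' s i) (unest' s i)) *
    (\prod_(i in Evenfix s) e (psnest s i)) *
    (\prod_(i in Oddfix s) f (psnest s i))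
  else 0.
Proof.
case: ifP => [/forallP Ds|/negbT]; last first.
  rewrite negb_forall => /existsP[i notD]; rewrite (bigD1 i) //= /wt.
  move: notD; case: (odd (pos i)); rewrite -ltnNge => lti.
    by rewrite -(inj_eq val_inj) /= ltn_eqF // lti mulr0 mul0r.
  by rewrite -(inj_eq val_inj) /= gtn_eqF // lti mulr0 mul0r.
rewrite cyc_cmax -prodr_const !(big_mkcond (fun i => i \in _)) -!big_split; apply: eq_bigr => i _ /=.
rewrite /wt !inE -!mulrA; congr (_ * _); move: (Ds i) => {Ds}.
have [eqi|neqi] := eqVneq (s i) i.
  have eqVi : (s^-1)%g i = i by apply: (@perm_inj _ s); rewrite permKV eqi.
  by rewrite eqi eqVi !ltnn /=; case: (odd _); rewrite /= ?mul1r ?mulr1.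
have neqVi : (s^-1)%g i != i by apply: contra_neq neqi => {1}<-; rewrite permKV.
rewrite -!(inj_eq val_inj) /= in neqi neqVi *.
case: (odd _) => /=; case: ltngtP neqi => //= _ _ _.
  by case: ltngtP neqVi => //= _ _; rewrite ?mul1r ?mulr1.
by case: ltngtP neqVi => //= _ _; rewrite ?mul1r ?mulr1.
Qed.

End WeightedSum.

(** Before anything is read, all permutations lie in the class of the empty matching, at height
    0. *)
Lemma Qhathat_pathsum (R : comNzRingType) (a : nat -> R) (b c d : nat -> nat -> R)
    (e f : nat -> R) (lambda : R) (n : nat) :
  Qhathat a b c d e f lambda n =
  pathsum a (peak_wt b lambda) (fall_wt c e lambda) (rise_wt d f lambda) n.*2 0.
Proof.
have trunc0 (s : {perm 'I_(2 * n)}) : trunc 0 s = set0.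
  by apply/setP=> x; rewrite !inE.
have pm0 : pmatching 0 (set0 : {set 'I_(2 * n) * 'I_(2 * n)}).
  by split=> [x|x y|x y]; rewrite inE.
have := @sum_wt_from R a b c d e f lambda (2 * n) (2 * n) 0 set0 _ (add0n _) pm0.
rewrite mul2n odd_double sub0n => <- //; rewrite /Qhathat big_mkcond -mul2n.
apply: eq_big => [s|s _]; first by rewrite trunc0 eqxx.
by rewrite -prod_wt.
Qed.

Unset Implicit Arguments.

Theorem theorem4p10 (R : comNzRingType) (a : nat -> R)
    (b c d : nat -> nat -> R) (e f : nat -> R) (lambda : R)
    (alpha delta : nat -> R)
    (alpha_odd : forall k : nat, (1 <= k)%N ->
       alpha (2 * k - 1)%N =
         (lambda + k%:R - 1) * a (k - 1)%N *
         \sum_(0 <= xi < k) b (k - 1 - xi)%N xi)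
    (alpha_even : forall k : nat, (1 <= k)%N ->
       alpha (2 * k)%N =
         (lambda * e k + \sum_(0 <= xi < k) c (k - 1 - xi)%N xi) *
         (lambda * f k + \sum_(0 <= xi < k) d (k - 1 - xi)%N xi))
    (delta_1 : delta 1%N = lambda ^+ 2 * e 0%N * f 0%N)
    (delta_ge2 : forall n : nat, (2 <= n)%N -> delta n = 0) :
  is_Tfraction (Qhathat a b c d e f lambda) alpha delta.
Proof.
move=> n; rewrite Qhathat_pathsum.
apply: (pathsum_Tfraction (A := a) (B := peak_wt b lambda) (C := fall_wt c e lambda)
  (D := rise_wt d f lambda) (alpha := alpha) (delta := delta)).
(* At height 0 there is no open target, so the sum over [b] is empty. *)
- by rewrite /peak_wt big_geq // mulr0.
- move=> k; have := alpha_odd k.+1 isT.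
  by rewrite mul2n doubleS !subn1 /= => ->; rewrite /peak_wt -mulrA mulrCA subn1.
- by move=> k; rewrite -doubleS -mul2n alpha_even.
- by rewrite delta_1 /fall_wt /rise_wt !big_geq // !addr0; ring.
- by move=> k; apply: delta_ge2.
Qed.
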